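(* Let $G$ be a finite soluble group. Then $G$ is a $PST$-group if and only if ${\cal L}_{\mathfrak{N}}(G)={\cal L}_{\Delta}(G)$, where $\mathfrak{N}$ is the class of all nilpotent groups and $\Delta$ is the set of all central chief factors of $G$.
   Context: For $A\le G$: $A^{G}$ is the normal closure of $A$ in $G$ and $A_{G}=\bigcap_{x\in G}A^{x}$ is the core of $A$ in $G$. A subgroup $A$ of $G$ is $S$-permutable (equivalently, $S$-quasinormal) in $G$ if $AH=HA$ for all Sylow subgroups $H$ of $G$. $G$ is a $PST$-group if every subnormal subgroup of $G$ is $S$-permutable in $G$. A chief factor of $G$ is a section $H/K$ with $K<H$ normal in $G$ and $H/K$ a minimal normal subgroup of $G/K$; it is central if $H/K\le Z(G/K)$. For a set $\Delta$ of chief factors of $G$ and normal subgroups $L\le T$ of $G$, write $T/L\le Z_{\Delta}(G)$ if either $L=T$, or $L<T$ and $H/K\in\Delta$ for every chief factor $H/K$ of $G$ with $L\le K<H\le T$. ${\cal L}_{\Delta}(G)$ is the set of all subgroups $A$ of $G$ such that $A^{G}/A_{G}\le Z_{\Delta}(G)$. ${\cal L}_{\mathfrak{N}}(G)$ is the set of all subgroups $A$ of $G$ such that $A^{G}/A_{G}$ is nilpotent. *)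

(* Defs.v *)
From mathcomp Require Import all_boot all_fingroup all_solvable.
Set Implicit Arguments.
Unset Strict Implicit.
Unset Printing Implicit Defensive.
Import GroupScope.

Section Defs.

Variable gT : finGroupType.
Implicit Types (G A H K L T : {group gT}).

Definition normal_closure (A G : {set gT}) : {set gT} :=
  <<class_support A G>>.

Canonical normal_closure_group (A G : {set gT}) : {group gT} :=
  Eval hnf in [group of normal_closure A G].

Definition S_permutable A G : bool :=
  (A \subset G) && [forall H : {group gT}, Sylow G H ==> (A * H == H * A)].

Definition PST_group G : bool :=
  [forall A : {group gT}, (A <|<| G) ==> S_permutable A G].

(* A section H / K is represented by the pair (H, K); note that MathComp's
   chief_factor G K H takes the lower term K first. *)
Definition central_chief_factors G : {set {group gT} * {group gT}} :=
  [set HK : {group gT} * {group gT} |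
    chief_factor G HK.2 HK.1 && (HK.1 / HK.2 \subset 'Z(G / HK.2))].

(* T / L <= Z_Delta(G), for normal subgroups L <= T of G. *)
Definition section_le_Z (Delta : {set {group gT} * {group gT}}) G T L : bool :=
  (L :==: T) ||
  (L \proper T) &&
  [forall H : {group gT}, forall K : {group gT},
    [&& chief_factor G K H, L \subset K & H \subset T] ==>
      ((H, K) \in Delta)].

Definition L_Delta (Delta : {set {group gT} * {group gT}}) G :
    {set {group gT}} :=
  [set A : {group gT} | (A \subset G) &&
    section_le_Z Delta G [group of normal_closure A G] [group of gcore A G]].

Definition L_nil G : {set {group gT}} :=
  [set A : {group gT} | (A \subset G) &&
    nilpotent (normal_closure A G / gcore A G)].

End Defs.

(* Main.v *)
Require Import Defs.
From mathcomp Require Import all_boot all_fingroup all_solvable.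

Set Implicit Arguments.
Unset Strict Implicit.
Unset Printing Implicit Defensive.
Import GroupScope.

(** Write [T] and [L] for the normal closure and the core of [A] in [G]. That
    [A] belongs to [L_Delta] for the central chief factors says that [T / L] is
    hypercentral in [G / L]; this makes [T / L] nilpotent, so [L_Delta] is
    always contained in [L_nil], and the theorem is about the reverse inclusion.
    For nilpotent [T / L], hypercentrality means that, for every prime [p], the
    [p']-subgroups of [G / L] centralise ['O_p(T / L)]
    ([central_section_p'cent], [central_section_of_p'cent]).

    Both the PST property and the inclusion of [L_nil] in [L_Delta] imply, for
    [G] and for its quotients by ['O_p^'(G)], the condition [power_pcore]: the
    [p']-subgroups normalise every subgroup of the [p]-core. A nontrivial group
    of [p']-power automorphisms of a [p]-group acts without fixed points and
    forces the [p]-group to be abelian ([power_abelian]). In a soluble group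
    this gives, for each prime [p], an alternative
    ([power_pcore_dichotomy]): either [G / 'O_p^'(G)] is a [p]-group, or every
    subgroup of ['O_p(G)] is normal in [G] and the derived group of
    [G / 'O_p^'(G)] is a [p]-group.

    If [G] is a PST-group and [T / L] is nilpotent, factor out [L], so that [A]
    has trivial core. In the first case the [p']-subgroups lie in ['O_p^'(G)]
    and centralise ['O_p(T)]. In the second ['O_p(A)] is normal in [G], hence
    trivial, and then so is ['O_p(T)].

    Conversely, suppose that [L_nil] is contained in [L_Delta], and let [D] be
    the nilpotent residual of [G]. The alternative shows that [D] is nilpotent
    and that all its subgroups are normal in [G]. If [A] is subnormal, the
    nilpotent residual of [A] lies in [A :&: D], which is normal in [G] and
    therefore contained in [L]. Thus [A / L] is a nilpotent subnormal subgroup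
    of [G / L], so [T / L] is nilpotent, [T / L] is hypercentral by assumption,
    and [A] permutes with the Sylow subgroups of [G]
    ([S_permutable_of_p'cent]). *)

(** * Coprime action and the Fitting subgroup *)

Section CoprimeAction.

Variable gT : finGroupType.
Implicit Types (A B F G H K P Q : {group gT}) (p : nat).

Lemma coprime_comm_mul_cent A G :
    A \subset 'N(G) -> coprime #|G| #|A| -> solvable G ->
  [~: G, A] * 'C_G(A) = G.
Proof.
move=> nGA coGA solG; set R := [~: G, A].
have sRG: R \subset G by rewrite commg_subl.
have nRG: G \subset 'N(R) by rewrite commg_norml.
have defC: 'C_G(A) / R = 'C_(G / R)(A / R).
  apply: coprime_norm_quotient_cent => //.
  - by rewrite commg_normr.
  - exact: coprimeSg coGA.
  - exact: solvableS solG.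
apply/eqP; rewrite eqEsubset mul_subG ?subsetIl //=.
by rewrite -quotientSK // defC subsetI subxx quotient_cents2r.
Qed.

Lemma coprime_comm_id A G :
    A \subset 'N(G) -> coprime #|G| #|A| -> solvable G ->
  [~: G, A, A] = [~: G, A].
Proof.
move=> nGA coGA solG; set R := [~: G, A].
have nRC: 'C_G(A) \subset 'N([~: R, A]).
  apply: normsR; last by rewrite cents_norm ?subsetIr.
  exact: subset_trans (subsetIl _ _) (commg_norml _ _).
rewrite {2}/R -{1}(coprime_comm_mul_cent nGA coGA solG) commMG //.
by rewrite (commG1P (subsetIr _ _)) mulg1.
Qed.

(** In a soluble group the Fitting subgroup contains its own centraliser [C].
    Otherwise [G / Z], for [Z := C :&: 'F(G)], has a nontrivial abelian normal
    subgroup [H / Z] inside [C / Z]; as [Z] is central in [H], the group [H] has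
    class at most 2 and lies in ['F(G)]. *)
Lemma sol_cent_Fitting G : solvable G -> 'C_G('F(G)) \subset 'F(G).
Proof.
move=> solG; set C := 'C_G('F(G)); set Z := C :&: 'F(G).
have nsCG: C <| G.
  by rewrite /normal subsetIl normsI ?normG ?norms_cent ?gFnorm.
have nsZG: Z <| G by rewrite normalI ?Fitting_normal.
have nsZC: Z <| C by rewrite (normalS _ _ nsZG) ?subsetIl.
case: (eqVneq (C / Z) 1) => [CZ1 | ntCZ].
  have: C \subset Z by rewrite -quotient_sub1 ?normal_norm // CZ1.
  by rewrite subsetI => /andP[].
have solC: solvable (C / Z) by rewrite quotient_sol // (solvableS _ solG) ?subsetIl.
have nsCZ: C / Z <| G / Z by rewrite quotient_normal.
have [Hb [sHC nsHG ntH abelH]] := solvable_norm_abelem solC nsCZ ntCZ.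
have [H defH sZH nsH] := inv_quotientN nsZG nsHG.
have nsZH: Z <| H by rewrite (normalS _ _ nsZG) ?(normal_sub nsH).
have sHCs: H \subset C.
  by rewrite -(quotientSGK (normal_norm nsZH) (normal_sub nsZC)) -defH.
case/negP: ntH; rewrite defH -subG1 quotient_sub1 ?normal_norm //.
rewrite subsetI sHCs Fitting_max //.
have abH: abelian (H / Z).
  by rewrite -defH; case/is_abelemP: abelH => q _ /and3P[].
apply: small_nil_class; apply: (@leq_trans 2) => //; rewrite nil_class2.
rewrite subsetI der_sub (subset_trans (der1_min (normal_norm nsZH) abH)) //.
by rewrite (subset_trans (subsetIr _ _)) // centsC (subset_trans sHCs) ?subsetIr.
Qed.

End CoprimeAction.

(** * Coprime groups of power automorphisms *)

Section PowerAction.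

Variables (gT : finGroupType) (p : nat).
Implicit Types (A B F G H K P Q W : {group gT}).

(** Two elements normalising every subgroup of [F] act on each cyclic subgroup
    of [F] as powers, so they commute there. *)
Lemma norm_subgroups_comm F x y :
    (forall B, B \subset F -> x \in 'N(B)) ->
    (forall B, B \subset F -> y \in 'N(B)) ->
  [~ x, y] \in 'C(F).
Proof.
move=> nFx nFy.
have powF z f: (forall B, B \subset F -> z \in 'N(B)) -> f \in F ->
  exists n, f ^ z = f ^+ n.
- move=> nFz Ff; apply/cycleP; rewrite memJ_norm ?cycle_id //.
  by rewrite nFz ?cycle_subG.
have comF f: f \in F -> f ^ (x * y) = f ^ (y * x).
  move=> Ff; have [[a fx] [b fy]] := (powF x f nFx Ff, powF y f nFy Ff).
  by rewrite !conjgM fx fy !conjXg fx fy -!expgM mulnC.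
have Fg f: f \in F -> f ^ (y * x)^-1 \in F.
  by move=> Ff; rewrite memJ_norm // groupV groupM ?nFx ?nFy.
apply/centP=> f Ff; rewrite /commute [RHS]conjgC.
have ->: [~ x, y] = (y * x)^-1 * (x * y) by rewrite /commg /conjg invMg !mulgA.
by rewrite conjgM comF ?Fg // conjgKV.
Qed.

Variables F Q : {group gT}.
Hypotheses (pF : p.-group F) (p'Q : p^'.-group Q).
Hypothesis nFQ : forall B, B \subset F -> Q \subset 'N(B).

Let coFQ : coprime #|F| #|Q|. Proof. exact: pnat_coprime pF p'Q. Qed.
Let solF : solvable F. Proof. exact: pgroup_sol pF. Qed.
Let nF : Q \subset 'N(F). Proof. exact: nFQ. Qed.

(** The elements normalising every subgroup of [F] form a group [W] containing
    [Q], normalised by [F], and whose derived group centralises [F]. Then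
    [~: F, Q] lies in [W], so that [~: F, Q] = [~: F, Q, Q] lies in
    [~: W, W]. *)
Lemma power_comm_central : [~: F, Q] \subset 'Z(F).
Proof.
pose W := (\bigcap_(B : {group gT} | B \subset F) 'N(B))%G.
have memW x B: x \in W -> B \subset F -> x \in 'N(B).
  by move=> Wx sBF; have /bigcapP := Wx; apply.
have sQW: Q \subset W by apply/bigcapsP=> B; apply: nFQ.
have nWF: F \subset 'N(W).
  apply/subsetP=> f Ff; rewrite inE; apply/subsetP=> _ /imsetP[w Ww ->].
  apply/bigcapP=> B sBF; have: w \in 'N(B :^ f^-1).
    by rewrite (memW w (B :^ f^-1)%G) //= sub_conjgV conjGid.
  by rewrite normJ mem_conjg invgK.
have cWF: [~: W, W] \subset 'C(F).
  rewrite gen_subG; apply/subsetP=> _ /imset2P[x y Wx Wy ->].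
  by apply: norm_subgroups_comm => B; apply: memW.
have sRW: [~: F, Q] \subset W.
  by apply: subset_trans (commgS _ sQW) _; rewrite commg_subr.
rewrite subsetI commg_subl nF -(coprime_comm_id nF coFQ solF) /=.
by apply: subset_trans cWF; apply: commgSS.
Qed.

Lemma power_cent_TI : 'C_[~: F, Q](Q) = 1.
Proof.
have sRZ := power_comm_central.
have sRF: [~: F, Q] \subset F by rewrite commg_subl.
have abR: abelian [~: F, Q] by apply: abelianS sRZ (center_abelian F).
rewrite -{1}(coprime_comm_id nF coFQ solF) coprime_abel_cent_TI //.
  by rewrite commg_normr.
exact: coprimeSg sRF coFQ.
Qed.

(** If [c] and [m] have order [p], with [c] centralised by [Q] and [m] in
    R := [~: F, Q], then for [y] in [Q] the commutator [~ c * m, y] = [~ m, y]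
    lies in R and in the group of order [p] generated by [c * m], which meet
    trivially. Hence [m] is centralised by [Q], which is impossible. *)
Lemma power_cent1 : [~: F, Q] != 1 -> 'C_F(Q) = 1.
Proof.
move=> ntR; have sRZ := power_comm_central; have trRC := power_cent_TI.
have sRF: [~: F, Q] \subset F by rewrite commg_subl.
have cRF: [~: F, Q] \subset 'C(F) by rewrite (subset_trans sRZ) ?subsetIr.
have pR: p.-group [~: F, Q] := pgroupS sRF pF.
have [p_pr p_dvR _] := pgroup_pdiv pR ntR.
have [m Rm om] := Cauchy p_pr p_dvR.
apply/eqP/idPn=> ntC; have pC: p.-group 'C_F(Q) := pgroupS (subsetIl _ _) pF.
have [_ p_dvC _] := pgroup_pdiv pC ntC.
have [c /setIP[Fc Cc] oc] := Cauchy p_pr p_dvC.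
have cmc: commute c m by apply/esym; apply: (centP (subsetP cRF m Rm)).
suffices: m \in 'C_[~: F, Q](Q).
  by rewrite trRC => /set1P m1; move: p_pr; rewrite -om m1 order1.
rewrite inE Rm; apply/centP=> y Qy; apply/commgP.
have Ry: [~ m, y] \in [~: F, Q] by rewrite mem_commg ?(subsetP sRF).
have cyc: [~ c * m, y] = [~ m, y].
  have /commgP/eqP cy1 := centP Cc y Qy.
  by rewrite commMgJ cy1 conj1g mul1g.
have: [~ c * m, y] \in <[c * m]>.
  have nB: Q \subset 'N(<[c * m]>).
    by apply: nFQ; rewrite cycle_subG groupM // (subsetP sRF).
  by rewrite commgEl groupM ?groupV ?memJ_norm ?cycle_id // (subsetP nB).
case/cycleP=> j defj.
have cj: c ^+ j \in 'C_[~: F, Q](Q).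
  apply/setIP; split; last by rewrite groupX.
  by rewrite -(groupMr _ (groupX j Rm)) -expgMn // -defj cyc.
move: cj; rewrite trRC => /set1P cj.
have mj: m ^+ j = 1 by apply/eqP; rewrite -order_dvdn om -oc order_dvdn cj.
by rewrite -cyc defj expgMn // cj mj mulg1.
Qed.

(** A nontrivial group of [p']-power automorphisms of a [p]-group forces the
    [p]-group to be abelian, and acts on it without fixed points. *)
Lemma power_abelian : ~~ (Q \subset 'C(F)) -> abelian F /\ 'C_F(Q) = 1.
Proof.
rewrite centsC (sameP commG1P eqP) => ntR; have CF1 := power_cent1 ntR.
split=> //; apply: abelianS (center_abelian F).
apply: subset_trans power_comm_central.
by rewrite -{1}(coprime_comm_mul_cent nF coFQ solF) CF1 mulg1.
Qed.

End PowerAction.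

(** * Groups whose [p']-subgroups act on the [p]-core by power automorphisms *)

(** Every [p']-subgroup of [G] normalises every subgroup of ['O_p(G)]. *)
Definition power_pcore (gT : finGroupType) (p : nat) (G : {group gT}) : Prop :=
  forall B Q : {group gT},
    B \subset 'O_p(G) -> Q \subset G -> p^'.-group Q -> Q \subset 'N(B).

Section PowerPcore.

Variables (gT : finGroupType) (p : nat).
Implicit Types (A B G H K P Q : {group gT}).

Lemma pHall_mul_p'Hall G P Q :
  p.-Hall(G) P -> p^'.-Hall(G) Q -> P * Q = G.
Proof. by move=> sylP; rewrite -(compl_pHall _ sylP) => /complP[]. Qed.

Lemma p'Hall_trivial_pgroup G Q : p^'.-Hall(G) Q -> Q :=: 1 -> p.-group G.
Proof.
by move/card_Hall=> cardQ Q1; rewrite -pgroupNK -partG_eq1 -cardQ Q1 cards1.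
Qed.

Lemma pgroup_p'group_trivial Q : p.-group Q -> p^'.-group Q -> Q :=: 1.
Proof. by move=> pQ p'Q; apply: card1_trivg; apply: pnat_1 pQ p'Q. Qed.

(** When ['O_p^'(G) = 1], put [F := 'O_p(G)] and let [P] be a Sylow
    [p]-subgroup. Unless [G] is a [p]-group, its [p']-subgroups act
    nontrivially on [F], hence without fixed points, and [E := F :&: 'Z(P)] is
    a nontrivial normal subgroup of [G]. A [p']-subgroup of ['C_G(E)] then
    centralises [F], so it is trivial; thus ['C_G(E)] is a normal [p]-subgroup
    of [G], and it contains [P]. *)
Lemma power_pcore_structure G :
    solvable G -> 'O_p^'(G) = 1 -> power_pcore p G ->
  p.-group G \/
  [/\ abelian 'O_p(G), p.-Sylow(G) 'O_p(G) & G^`(1) \subset 'O_p(G)].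
Proof.
move=> solG p'G1 powG; set F := 'O_p(G).
have pF: p.-group F := pcore_pgroup p G.
have sCF: 'C_G(F) \subset F.
  by rewrite /F -(Fitting_eq_pcore p'G1) sol_cent_Fitting.
have p'cent1 (Y : {group gT}):
  Y \subset G -> p^'.-group Y -> Y \subset 'C(F) -> Y :=: 1.
  move=> sYG p'Y cYF; apply: pgroup_p'group_trivial p'Y.
  by apply: pgroupS pF; apply: subset_trans sCF; rewrite subsetI sYG.
have [Q hallQ] := Hall_exists p^' solG.
have [sQG p'Q] := (pHall_sub hallQ, pHall_pgroup hallQ).
have [Q1 | ntQ] := eqVneq (Q : {set gT}) 1.
  by left; apply: p'Hall_trivial_pgroup hallQ Q1.
right; have nFQ (B : {group gT}): B \subset F -> Q \subset 'N(B).
  by move=> sBF; apply: powG.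
have ncQ: ~~ (Q \subset 'C(F)).
  by apply: contraNN ntQ => /(p'cent1 Q sQG p'Q)->.
have [abF _] := power_abelian pF p'Q nFQ ncQ.
have [P sylP] := Sylow_exists p G.
have [sPG pP] := (pHall_sub sylP, pHall_pgroup sylP).
have sFP: F \subset P := pcore_sub_Hall sylP.
have defG: P * Q = G := pHall_mul_p'Hall sylP hallQ.
have nsFP: F <| P := normalS sFP sPG (pcore_normal p G).
set E := F :&: 'Z(P); have sEF: E \subset F := subsetIl _ _.
have ntF: F != 1 by apply: contraNneq ncQ => ->; rewrite cents1.
have ntE: E != 1 by apply: meet_center_nil (pgroup_nil pP) nsFP ntF.
have cEP: P \subset 'C(E) by rewrite centsC subIset // subsetIr orbT.
have nEG: G \subset 'N(E) by rewrite -defG mul_subG ?nFQ // cents_norm.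
have nsCG: 'C_G(E) <| G.
  by rewrite /normal subsetIl normsI ?normG // norms_cent.
have sCG: 'C_G(E) \subset G := normal_sub nsCG.
have [Y hallY] := Hall_exists p^' (solvableS sCG solG).
have [sYC p'Y] := (pHall_sub hallY, pHall_pgroup hallY).
have [sYG cYE] := subsetIP sYC.
have cYF: Y \subset 'C(F).
  apply: contraR ntE => ncY.
  have [|_ CY1] := power_abelian pF p'Y _ ncY.
    by move=> B sBF; apply: powG.
  by rewrite -subG1 -CY1 subsetI sEF centsC.
have Y1 := p'cent1 Y sYG p'Y cYF.
have pC: p.-group 'C_G(E) := p'Hall_trivial_pgroup hallY Y1.
have sPF: P \subset F.
  by apply: subset_trans (pcore_max pC nsCG); rewrite subsetI sPG.
have defP: P :=: F by apply/eqP; rewrite eqEsubset sPF.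
split; rewrite // -?defP //.
have nFG (B : {group gT}): B \subset F -> G \subset 'N(B).
  move=> sBF; rewrite -defG mul_subG ?nFQ // cents_norm // defP.
  exact: subset_trans abF (centS sBF).
rewrite defP; apply: subset_trans sCF; rewrite subsetI der_sub gen_subG.
apply/subsetP=> _ /imset2P[x y Gx Gy ->].
by apply: norm_subgroups_comm => B sBF; apply: (subsetP (nFG B sBF)).
Qed.

End PowerPcore.

(** Applied to [G / 'O_p^'(G)], the previous lemma leaves two cases. When [G]
    is not [p]-nilpotent, its Sylow [p]-subgroups are abelian modulo
    ['O_p^'(G)], so they centralise ['O_p(G)], and all of [G] normalises the
    subgroups of ['O_p(G)]. *)
Lemma power_pcore_dichotomy (gT : finGroupType) (p : nat) (G : {group gT}) :
    solvable G -> power_pcore p G -> power_pcore p (G / 'O_p^'(G)) ->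
  p.-group (G / 'O_p^'(G)) \/
  (forall B : {group gT}, B \subset 'O_p(G) -> G \subset 'N(B)) /\
    p.-group (G / 'O_p^'(G))^`(1).
Proof.
move=> solG powG powGb; set R := 'O_p^'(G).
have nRG: G \subset 'N(R) := gFnorm _ _.
have [||pG|[abF sylF sG'F]] := power_pcore_structure _ _ powGb.
- exact: quotient_sol.
- exact: trivg_pcore_quotient.
- by left.
right; split; last exact: pgroupS sG'F (pcore_pgroup _ _).
have [P sylP] := Sylow_exists p G; have sPG := pHall_sub sylP.
have [Q hallQ] := Hall_exists p^' solG.
move=> B sBF; rewrite -(pHall_mul_p'Hall sylP hallQ) mul_subG //; last first.
  exact: powG (pHall_sub hallQ) (pHall_pgroup hallQ).
have defP: P / R = 'O_p(G / R).
  by apply: (eq_Hall_pcore sylF); rewrite quotient_pHall // (subset_trans sPG).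
have cFP: P \subset 'C('O_p(G)).
  have nFP: P \subset 'N('O_p(G)) := subset_trans sPG (gFnorm _ _).
  rewrite (sameP commG1P eqP) -subG1 -(TI_pcoreC p G G) subsetI commg_subr nFP.
  rewrite -quotient_cents2 ?(subset_trans sPG) //; last first.
    exact: subset_trans (pcore_sub _ _) nRG.
  rewrite defP (subset_trans abF) // centS //.
  rewrite pcore_max ?quotient_pgroup ?pcore_pgroup //.
  by rewrite quotient_normal ?pcore_normal.
by rewrite cents_norm // (subset_trans cFP) ?centS.
Qed.

(** * Soluble PST-groups *)

Section PST.

Variable gT : finGroupType.
Implicit Types (A B G H K N P Q : {group gT}).

Lemma PST_power_pcore p G : PST_group G -> power_pcore p G.
Proof.
move/forall_inP=> pstG B Q sBF sQG p'Q.
rewrite -(Sylow_gen Q) gen_subG; apply/bigcupsP=> S /SylowP[q _ sylS].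
have [sSQ qS] := (pHall_sub sylS, pHall_pgroup sylS).
have [eq_qp | neq_qp] := eqVneq q p.
  rewrite eq_qp in qS.
  by rewrite (pgroup_p'group_trivial qS (pgroupS sSQ p'Q)) sub1G.
have [H sylH sSH] := Sylow_superset (subset_trans sSQ sQG) qS.
apply: subset_trans sSH _; have sHG := pHall_sub sylH.
have pF: p.-group 'O_p(G) := pcore_pgroup p G.
have snBG: B <|<| G.
  apply: subnormal_trans (normal_subnormal (pcore_normal p G)).
  exact: nilpotent_subnormal (pgroup_nil pF) sBF.
have /andP[_ /forall_inP permB] := pstG B snBG.
have /eqP cBH := permB H (p_Sylow sylH).
have tiFH: 'O_p(G) :&: H = 1.
  apply: coprime_TIg; apply: pnat_coprime pF _.
  apply: pi_pnat (pHall_pgroup sylH) _.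
  by rewrite !inE.
have defB: 'O_p(G) :&: (B <*> H) = B.
  by rewrite (comm_joingE cBH) setIC -group_modl // setIC tiFH mulg1.
rewrite -{1}defB normsI //.
  exact: subset_trans sHG (gFnorm _ _).
by apply: subset_trans (joing_subr B H) (normG _).
Qed.

Lemma cosetpre_subnormal N (A K : {group coset_of N}) :
  A <|<| K -> coset N @*^-1 A <|<| coset N @*^-1 K.
Proof.
case/subnormalP=> s snA <-{K}.
elim: s A snA => [|K s IHs] A /=; first by rewrite subnormal_refl.
case/andP=> nsAK /IHs; apply: subnormal_trans.
by rewrite normal_subnormal ?cosetpre_normal.
Qed.

Lemma PST_quotient N G : N <| G -> PST_group G -> PST_group (G / N).
Proof.
move=> nsNG /forall_inP pstG; apply/forall_inP=> A snA.
have nNG := normal_norm nsNG.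
have snB: coset N @*^-1 A <|<| G.
  by rewrite -(quotientGK nsNG) cosetpre_subnormal.
rewrite /S_permutable subnormal_sub //=.
apply/forall_inP=> H /SylowP[q _ sylH].
have [P sylP] := Sylow_exists q G; have sPG := pHall_sub sylP.
have sylPN: q.-Sylow(G / N) (P / N).
  by rewrite quotient_pHall // (subset_trans sPG).
have [_ /morphimP[x Nx Gx ->] defH] := Sylow_trans sylPN sylH.
rewrite -quotientJ // in defH.
have /andP[_ /forall_inP permB] := pstG _ snB.
have /eqP cBP := permB (P :^ x)%G (p_Sylow (etrans (pHallJ _ _ Gx) sylP)).
have nNPx: P :^ x \subset 'N(N) by rewrite (subset_trans _ nNG) ?conj_subG.
by rewrite defH -(cosetpreK A) -quotientMr // cBP quotientMl.
Qed.

End PST.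

(** * Sections all of whose chief factors are central *)

Section NormalClosure.

Variable gT : finGroupType.
Implicit Types A G K : {group gT}.

Lemma sub_normal_closure A G : A \subset normal_closure A G.
Proof. exact: subset_trans (sub_class_support G A) (subset_gen _). Qed.

Lemma normal_closure_normal A G : A \subset G -> normal_closure A G <| G.
Proof.
move=> sAG; rewrite /normal gen_subG class_support_subG //.
by rewrite norms_gen ?class_support_norm.
Qed.

Lemma normal_closure_min A G K :
  A \subset K -> G \subset 'N(K) -> normal_closure A G \subset K.
Proof. by move=> sAK nKG; rewrite gen_subG class_support_sub_norm. Qed.

End NormalClosure.

Section CentralSection.

Variable gT : finGroupType.
Implicit Types A G H K L P Q T : {group gT}.

(** The hypothesis on chief factors says that [T / L] is hypercentral in
    [G / L]. Let [K] be minimal among the [G]-invariant subgroups containing [L]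
    and the preimage of [X]. If [K] were not [L], it would be the top of a chief
    factor [K / M] with [M] above [L]; since that factor is central, [M] would
    contain [~: K, G], and with it the preimage of [X]. *)
Lemma central_section_comm G T L (X : {group coset_of L}) :
    T <| G -> L <| G -> L \subset T ->
    section_le_Z (central_chief_factors G) G T L ->
  X \subset T / L -> X \subset [~: X, G / L] -> X :=: 1.
Proof.
move=> nsTG nsLG sLT centTL sXT sXXG.
have nLG := normal_norm nsLG; pose Y := (coset L @*^-1 X)%G.
have nsLT: L <| T := normalS sLT (normal_sub nsTG) nsLG.
suffices sYL: Y \subset L.
  by apply/trivgP; rewrite -(cosetpreK X) quotient_sub1 ?subsetIl.
pose gK K := [&& L \subset K, G \subset 'N(K) & Y \subset K].
have gKT: gK T.
  by rewrite /gK sLT (normal_norm nsTG) -(quotientGK nsLT) morphpreS.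
have [K /mingroupP[/and3P[sLK nKG sYK] minK] sKT] := mingroup_exists gKT.
have [eqLK | neqLK] := eqVneq L K; first by rewrite -eqLK in sYK.
have prLK: L \proper K.
  by rewrite properEneq sLK andbT; apply: contraNneq neqLK => /val_inj->.
have [|M maxM sLM] :=
  @maxgroup_exists _ (fun M => (M \proper K) && (G \subset 'N(M))) L.
  by rewrite prLK nLG.
have sMK: M \subset K := maxnormal_sub maxM.
have /andP[prMK nMG] := maxgroupp maxM.
have sKG: K \subset G := subset_trans sKT (normal_sub nsTG).
have chiefMK: chief_factor G M K by rewrite /chief_factor /maxnormal maxM /normal sKG.
have prLT: L \proper T := proper_sub_trans prLK sKT.
have cKM: [~: K, G] \subset M.
  case/orP: centTL => [/eqP eqLT | /andP[_ /forallP/(_ K)/forallP/(_ M)]].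
    by rewrite eqLT properxx in prLT.
  rewrite chiefMK sLM sKT /= inE /= => /andP[_ sKZ].
  rewrite -quotient_cents2 ?(subset_trans sKG) //.
  by rewrite (subset_trans sKZ) ?subsetIr.
have nsLM: L <| M.
  by apply: normalS nsLG => //; apply: subset_trans sMK sKG.
have sYM: Y \subset M.
  rewrite -(quotientGK nsLM) morphpreS // (subset_trans sXXG) //.
  have sXK: X \subset K / L by rewrite -(cosetpreK X) quotientS.
  rewrite (subset_trans (commSg _ sXK)) // -quotientR ?quotientS //.
  exact: subset_trans sKG nLG.
have defM: M :=: K by apply: minK => //; rewrite /gK sLM nMG.
by rewrite defM properxx in prMK.
Qed.

Lemma central_section_nil G T L :
    T <| G -> L <| G -> L \subset T ->
    section_le_Z (central_chief_factors G) G T L ->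
  nilpotent (T / L).
Proof.
move=> nsTG nsLG sLT centTL; apply/forall_inP=> X /subsetIP[sXT sXXT].
apply/eqP; apply: central_section_comm centTL sXT _ => //.
by apply: subset_trans sXXT _; rewrite commgS ?quotientS ?normal_sub.
Qed.

Lemma central_section_p'cent (p : nat) G T L (Q : {group coset_of L}) :
    T <| G -> L <| G -> L \subset T ->
    section_le_Z (central_chief_factors G) G T L ->
  Q \subset G / L -> p^'.-group Q -> Q \subset 'C('O_p(T / L)).
Proof.
move=> nsTG nsLG sLT centTL sQG p'Q; set V := 'O_p(T / L).
have pV: p.-group V := pcore_pgroup _ _.
have nVQ: Q \subset 'N(V).
  apply: subset_trans sQG _; apply: gFnorm_trans.
  by rewrite quotient_norms ?normal_norm.
have coVQ: coprime #|V| #|Q| := pnat_coprime pV p'Q.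
rewrite centsC (sameP commG1P eqP); apply/eqP.
apply: (central_section_comm nsTG nsLG sLT centTL).
  by apply: subset_trans (pcore_sub p _); rewrite commg_subl.
rewrite /= -{1}(coprime_comm_id nVQ coVQ (pgroup_sol pV)).
exact: commgS.
Qed.

(** In [G / L] a Sylow [p]-subgroup contains ['O_p(A / L)] and centralises
    ['O_p^'(A / L)], so it permutes with [A / L]. *)
Lemma S_permutable_of_p'cent A G :
    A \subset G -> nilpotent (normal_closure A G / gcore A G) ->
    (forall (p : nat) (Q : {group coset_of (gcore A G)}),
       Q \subset G / gcore A G -> p^'.-group Q ->
       Q \subset 'C('O_p(normal_closure A G / gcore A G))) ->
  S_permutable A G.
Proof.
move=> sAG; set T := normal_closure A G; set L := gcore A G => nilT centT.
rewrite /S_permutable sAG; apply/forall_inP=> P /SylowP[p _ sylP].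
have sPG := pHall_sub sylP; have sLA: L \subset A := gcore_sub A G.
have nLG: G \subset 'N(L) := gcore_norm A G.
have [nLA nLP] := (subset_trans sAG nLG, subset_trans sPG nLG).
have nsTG: T <| G := normal_closure_normal sAG.
have sAT: A / L \subset T / L := quotientS L (sub_normal_closure A G).
have pP: p.-group (P / L) := quotient_pgroup L (pHall_pgroup sylP).
have nilA: nilpotent (A / L) := nilpotentS sAT nilT.
have cAP: P / L \subset 'C('O_p^'(A / L)).
  rewrite centsC -(Sylow_gen 'O_p^'(A / L)) gen_subG.
  apply/bigcupsP=> S /SylowP[q _ sylS].
  have [sSO qS] := (pHall_sub sylS, pHall_pgroup sylS).
  have p'S: p^'.-group S := pgroupS sSO (pcore_pgroup _ _).
  have [eq_qp | neq_qp] := eqVneq q p.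
    by rewrite (pgroup_p'group_trivial _ p'S) ?sub1G -?eq_qp.
  rewrite centsC (subset_trans (centT q _ _ _)) ?quotientS //.
    by apply: pi_pnat pP _; rewrite !inE eq_sym.
  rewrite centS // (sub_Hall_pcore (nilpotent_pcore_Hall q nilT)) //.
  exact: subset_trans sSO (subset_trans (pcore_sub _ _) sAT).
have sAP: 'O_p(A / L) \subset P / L.
  have sylPL: p.-Sylow(G / L) (P / L) by rewrite quotient_pHall.
  apply: subset_trans (pcore_sub_Hall sylPL).
  apply: (@subset_trans _ _ (mem 'O_p(T / L))).
    rewrite (sub_Hall_pcore (nilpotent_pcore_Hall p nilT)) ?pcore_pgroup //.
    exact: subset_trans (pcore_sub _ _) sAT.
  by rewrite pcore_max ?pcore_pgroup // gFnormal_trans ?quotient_normal.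
have [_ defA cUV _] := dprodP (nilpotent_pcoreC p nilA).
have cAPL: A / L * (P / L) = P / L * (A / L).
  rewrite -{2}defA mulgA (mulGSid sAP) (centC cAP).
  by rewrite -{1}defA -(centC cUV) -mulgA (mulSGid sAP).
have cLP: L * P = P * L by rewrite (normC nLP).
have defAP: A * P = coset L @*^-1 (A / L * (P / L)).
  by rewrite -quotientMl // quotientK ?mul_subG // mulgA (mulSGid sLA).
have defPA: P * A = coset L @*^-1 (P / L * (A / L)).
  by rewrite -quotientMl // quotientK ?mul_subG // mulgA cLP -mulgA (mulSGid sLA).
by rewrite defAP defPA cAPL.
Qed.

End CentralSection.

(** Let [M := 'O_p^'(H) * K]. The [p]-group [H / M] is centralised by the image
    of a Hall [p']-subgroup of [G], so its commutator with [G / M] is its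
    commutator with a Sylow [p]-subgroup, which contains it and is nilpotent;
    hence [H / M] is trivial and [H / K] is a [p']-group, for every [p]. *)
Lemma comm_cover_trivial (gT : finGroupType) (G N H K : {group gT}) :
    solvable G -> N <| G -> nilpotent N ->
    (forall (p : nat) (Q : {group gT}),
       Q \subset G -> p^'.-group Q -> Q \subset 'C('O_p(N))) ->
    H <| G -> K <| G -> K \subset H -> H \subset N ->
  H \subset [~: H, G] * K -> H \subset K.
Proof.
move=> solG nsNG nilN centN nsHG nsKG sKH sHN sHHG.
have nilH := nilpotentS sHN nilN.
have [sHG nHG] := andP nsHG; have nKG := normal_norm nsKG.
have nKH := subset_trans sHG nKG.
suffices p'HK (p : nat): p^'.-group (H / K).
  rewrite -quotient_sub1 // subG1.
  have [-> // | [p p_pr p_dv]] := trivgVpdiv (H / K)%G.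
  by have := pgroupP (p'HK p) p p_pr p_dv; rewrite !inE eqxx.
have [_ defH cOO _] := dprodP (nilpotent_pcoreC p nilH).
have nsOG: 'O_p^'(H) <| G by rewrite gFnormal_trans.
pose M := ('O_p^'(H) <*> K)%G.
have nsMG: M <| G by rewrite normalY.
have sMH: M \subset H by rewrite join_subG pcore_sub.
have nMG := normal_norm nsMG; have nMH := subset_trans sHG nMG.
suffices sHM: H \subset M.
  have sHKO: H / K \subset 'O_p^'(H) / K.
    rewrite (subset_trans (quotientS K sHM)) //= quotientYidr //.
    exact: subset_trans (pcore_sub _ _) nKH.
  exact: pgroupS sHKO (quotient_pgroup _ (pcore_pgroup _ _)).
have [P sylP] := Sylow_exists p G; have sPG := pHall_sub sylP.
have [Q hallQ] := Hall_exists p^' solG.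
have [sQG p'Q] := (pHall_sub hallQ, pHall_pgroup hallQ).
have defHM: H / M = 'O_p(H) / M.
  rewrite -{1}defH quotientMl ?(subset_trans (pcore_sub _ _)) //.
  by rewrite (quotientS1 (joing_subl _ _)) mulg1.
have sHP: H / M \subset P / M.
  rewrite defHM quotientS // (subset_trans _ (pcore_sub_Hall sylP)) //.
  by rewrite pcore_max ?pcore_pgroup ?gFnormal_trans.
have cHQ: [~: Q / M, H / M] = 1.
  apply/commG1P; rewrite defHM quotient_cents //.
  rewrite (subset_trans (centN p Q sQG p'Q)) // centS //.
  rewrite (sub_Hall_pcore (nilpotent_pcore_Hall p nilN)) ?pcore_pgroup //.
  exact: subset_trans (pcore_sub _ _) sHN.
have defGM: G / M = Q / M * (P / M).
  rewrite -quotientMl ?(subset_trans sQG) //.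
  have defG := pHall_mul_p'Hall sylP hallQ.
  by congr (_ / M); rewrite -defG; apply/comm_group_setP; rewrite defG groupP.
have sHHP: H / M \subset [~: H / M, P / M].
  have: H / M \subset [~: H / M, G / M].
    rewrite -quotientR // (subset_trans (quotientS M sHHG)) //.
    rewrite quotientMl ?(subset_trans _ nMH) ?commg_subl //.
    by rewrite (quotientS1 (joing_subr _ _)) mulg1.
  by rewrite defGM ![[~: H / M, _]]commGC commMG cHQ ?mul1g ?norm1 ?subsetT.
have nilP: nilpotent (P / M).
  by rewrite quotient_nil // (pgroup_nil (pHall_pgroup sylP)).
rewrite -quotient_sub1 // subG1.
by have /forall_inP := nilP; apply; rewrite subsetI sHP.
Qed.

(** A noncentral chief factor [H / K] satisfies H = [~: H, G] * K, which
    [comm_cover_trivial] excludes in [G / L]. *)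
Lemma central_section_of_p'cent (gT : finGroupType) (G T L : {group gT}) :
    solvable G -> T <| G -> L <| G -> L \subset T -> nilpotent (T / L) ->
    (forall (p : nat) (Q : {group coset_of L}),
       Q \subset G / L -> p^'.-group Q -> Q \subset 'C('O_p(T / L))) ->
  section_le_Z (central_chief_factors G) G T L.
Proof.
move=> solG nsTG nsLG sLT nilT centT; rewrite /section_le_Z.
have [eqLT | neqLT] //= := eqVneq (L : {set gT}) T.
rewrite properEneq neqLT sLT /=; apply/forallP=> H; apply/forallP=> K.
apply/implyP=> /and3P[chiefHK sLK sHT]; rewrite inE /= chiefHK /=.
have /andP[/maxgroupP[/andP[prKH nKG] maxK] nsHG] := chiefHK.
have [sHG nHG] := andP nsHG; have nLG := normal_norm nsLG.
have sKH := proper_sub prKH; have nKH := subset_trans sHG nKG.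
have nsKG: K <| G by rewrite /normal (subset_trans sKH).
rewrite subsetI quotientS //= quotient_cents2 //.
pose M := ([~: H, G] <*> K)%G.
have sMH: M \subset H by rewrite join_subG sKH commg_subl nHG.
have nMG: G \subset 'N(M) by rewrite normsY // commg_normr.
have [defM | neqMH] := eqVneq (M : {set gT}) H; last first.
  have <-: M :=: K by apply: maxK; rewrite ?joing_subr // properEneq neqMH sMH.
  exact: joing_subl.
case/negP: (proper_subn prKH).
rewrite -(quotientSGK (subset_trans sHG nLG) sLK).
apply: (comm_cover_trivial (G := G / L) (N := T / L)) => //=.
all: rewrite ?quotient_sol ?quotient_normal ?quotientS //.
have nLR: [~: H, G] \subset 'N(L).
  by rewrite (subset_trans _ nLG) // (subset_trans _ sHG) // commg_subl.
rewrite -quotientR ?(subset_trans sHG) // -quotientMl // quotientS //.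
rewrite -norm_joinEr; first by rewrite -{1}defM.
exact: subset_trans sKH (commg_norml _ _).
Qed.

(** * The two implications *)

Lemma L_Delta_sub_L_nil (gT : finGroupType) (G : {group gT}) :
  L_Delta (central_chief_factors G) G \subset L_nil G.
Proof.
apply/subsetP=> A; rewrite !inE => /andP[sAG centA]; rewrite sAG /=.
apply: central_section_nil centA => /=.
- exact: normal_closure_normal.
- exact: gcore_normal.
- exact: subset_trans (gcore_sub A G) (sub_normal_closure A G).
Qed.

(** The last two hypotheses on [A] say that its core is trivial and that its
    normal closure is [N]; they are stated so as to be easily transferred to a
    quotient group. *)
Lemma PST_core_free_p'cent (gT : finGroupType) (p : nat) (G A N Q : {group gT}) :
    solvable G -> PST_group G -> N <| G -> nilpotent N -> A \subset N ->
    (forall B : {group gT}, B \subset A -> G \subset 'N(B) -> B :=: 1) ->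
    (forall K : {group gT}, A \subset K -> G \subset 'N(K) -> N \subset K) ->
  Q \subset G -> p^'.-group Q -> Q \subset 'C('O_p(N)).
Proof.
move=> solG pstG nsNG nilN sAN coreA closA sQG p'Q.
have sOO: 'O_p(N) \subset 'O_p(G).
  by rewrite pcore_max ?pcore_pgroup ?gFnormal_trans.
have pstGR: PST_group (G / 'O_p^'(G)) by rewrite PST_quotient ?pcore_normal.
have [pGR | [nOG _]] := power_pcore_dichotomy solG (PST_power_pcore pstG)
                          (PST_power_pcore pstGR).
  have sQR: Q \subset 'O_p^'(G).
    rewrite -quotient_sub1 ?(subset_trans sQG) ?gFnorm // subG1; apply/eqP.
    apply: (@pgroup_p'group_trivial _ p (Q / _)%G).
      by rewrite (pgroupS _ pGR) // quotientS.
    exact: quotient_pgroup.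
  rewrite (subset_trans sQR) // (sameP commG1P eqP) -subG1.
  rewrite -(TI_pcoreC p N G) setIC commg_subI //.
    rewrite subsetI subxx (subset_trans (pcore_sub _ _)) ?gFnorm_trans //.
    exact: normal_norm.
  rewrite subsetI subxx (subset_trans (pcore_sub _ _)) //.
  exact: subset_trans (normal_sub nsNG) (gFnorm _ _).
have nilA := nilpotentS sAN nilN.
have sAO: 'O_p(A) \subset 'O_p(N).
  rewrite (sub_Hall_pcore (nilpotent_pcore_Hall p nilN)) ?pcore_pgroup //.
  exact: subset_trans (pcore_sub _ _) sAN.
have OA1: 'O_p(A) = 1.
  by apply: coreA; rewrite ?pcore_sub // nOG // (subset_trans sAO).
have sNO: N \subset 'O_p^'(N).
  apply: closA; last by rewrite gFnorm_trans ?normal_norm.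
  rewrite (sub_Hall_pcore (nilpotent_pcore_Hall p^' nilN)) //.
  have [_ <- _ _] := dprodP (nilpotent_pcoreC p nilA).
  by rewrite OA1 mul1g pcore_pgroup.
have ->: 'O_p(N) = 1.
  rewrite -(TI_pcoreC p N N); apply/esym/setIidPl.
  exact: subset_trans (pcore_sub _ _) sNO.
exact: cents1.
Qed.

Lemma PST_L_nil_sub_L_Delta (gT : finGroupType) (G : {group gT}) :
    solvable G -> PST_group G ->
  L_nil G \subset L_Delta (central_chief_factors G) G.
Proof.
move=> solG pstG; apply/subsetP=> A; rewrite !inE => /andP[sAG nilT].
have nsLG: gcore A G <| G := gcore_normal sAG.
have nsTG: normal_closure A G <| G := normal_closure_normal sAG.
have sLA: gcore A G \subset A := gcore_sub A G.
have sAT: A \subset normal_closure A G := sub_normal_closure A G.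
rewrite sAG central_section_of_p'cent //=; first exact: subset_trans sLA sAT.
move=> p Q sQG p'Q.
have nsLA: gcore A G <| A := normalS sLA sAG nsLG.
have nLG := normal_norm nsLG.
have nLA := subset_trans sAG nLG.
apply: (PST_core_free_p'cent (G := G / gcore A G) (A := A / gcore A G)
          (N := normal_closure A G / gcore A G)) => //=.
- exact: quotient_sol.
- exact: PST_quotient.
- exact: quotient_normal.
- exact: quotientS.
- move=> B sBA nBG; rewrite -(cosetpreK B); apply: quotientS1.
  apply: gcore_max; last exact: norm_quotient_pre.
  by rewrite -(quotientGK nsLA) morphpreS.
- move=> K sAK nKG; rewrite sub_quotient_pre; last first.
    exact: subset_trans (normal_sub nsTG) nLG.
  apply: normal_closure_min; last exact: norm_quotient_pre.
  by rewrite -sub_quotient_pre.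
Qed.

Section HypercentralSections.

Variables (gT : finGroupType) (G : {group gT}).
Implicit Types A B H K P Q R : {group gT}.
Hypothesis solG : solvable G.
Hypothesis sLL : L_nil G \subset L_Delta (central_chief_factors G) G.

(** If [B / R] is a subgroup of ['O_p(G / R)], the section of [G] between the
    core and the normal closure of [B] is a [p]-group; being hypercentral, it
    is centralised by the [p']-subgroups, so these normalise [B]. *)
Lemma hypercentral_power (p : nat) R B Q :
    R <| G -> R \subset B -> B \subset G -> B / R \subset 'O_p(G / R) ->
  Q \subset G -> p^'.-group (Q / R) -> Q \subset 'N(B).
Proof.
move=> nsRG sRB sBG sBO sQG p'Q; have nRG := normal_norm nsRG.
set T := normal_closure B G; set L := gcore B G.
have nsLG: L <| G := gcore_normal sBG.
have nsTG: T <| G := normal_closure_normal sBG.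
have sBT: B \subset T := sub_normal_closure B G.
have sLB: L \subset B := gcore_sub B G.
have sLT := subset_trans sLB sBT.
have sRL: R \subset L by rewrite gcore_max.
have nLG := normal_norm nsLG.
have pquo pi (X : {group gT}):
  X \subset G -> pi.-group (X / R) -> pi.-group (X / L).
  move=> sXG; apply: pnat_dvd; apply: card_homg.
  by rewrite homg_quotientS // (subset_trans sXG).
have pT: p.-group (T / L).
  apply: pquo (normal_sub nsTG) _.
  apply: (@pgroupS _ _ 'O_p(G / R)); last exact: pcore_pgroup.
  rewrite sub_quotient_pre; last exact: subset_trans (normal_sub nsTG) nRG.
  apply: normal_closure_min; last by rewrite norm_quotient_pre ?gFnorm.
  by rewrite -sub_quotient_pre // (subset_trans sBG).
have /(subsetP sLL): B \in L_nil G by rewrite inE sBG (pgroup_nil pT).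
rewrite inE sBG => /(central_section_p'cent nsTG nsLG sLT) centT.
have nsLB: L <| B := normalS sLB sBG nsLG.
rewrite -(quotientGK nsLB) norm_quotient_pre ?(subset_trans sQG) //.
rewrite cents_norm // (subset_trans (centT p _ _ (pquo _ _ sQG p'Q))) ?quotientS //.
by rewrite pcore_pgroup_id // centS ?quotientS.
Qed.

Lemma hypercentral_dichotomy (p : nat) :
  p.-group (G / 'O_p^'(G)) \/
  (forall B : {group gT}, B \subset 'O_p(G) -> G \subset 'N(B)) /\
    p.-group (G / 'O_p^'(G))^`(1).
Proof.
apply: power_pcore_dichotomy => // [B Q sBO sQG p'Q | B Q sBO sQG p'Q].
  apply: (@hypercentral_power p 1%G) => //; rewrite ?normal1 ?sub1G //.
  - exact: subset_trans sBO (pcore_sub _ _).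
  - by rewrite pquotient_pcore ?normal1 ?pgroup1 // quotientS.
  - exact: quotient_pgroup.
have nsRG: 'O_p^'(G) <| G := pcore_normal _ G.
have [B1 defB sRB sBG] := inv_quotientS nsRG (subset_trans sBO (pcore_sub _ _)).
have [Q1 defQ sRQ sQ1G] := inv_quotientS nsRG sQG.
rewrite defB defQ quotient_norms //.
apply: (hypercentral_power (p := p) nsRG) => //; first by rewrite -defB.
by move: p'Q; rewrite defQ.
Qed.

(** The term ['L_n(G)] with [n = #|G|.+1] is the nilpotent residual of [G]. For
    every [p] it is a [p]-group modulo ['O_p^'(G)], so it is nilpotent. *)
Lemma hypercentral_residual_pgroup (p : nat) :
  p.-group ('L_#|G|.+1(G) / 'O_p^'(G)).
Proof.
have nRG: G \subset 'N('O_p^'(G)) := gFnorm _ _.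
have [pG | [_ pG']] := hypercentral_dichotomy p.
  by apply: pgroupS pG; rewrite quotientS ?lcn_sub.
apply: pgroupS pG'; rewrite /= -quotient_der // quotientS // -lcn2.
by rewrite lcn_sub_leq // ltnS cardG_gt0.
Qed.

Lemma hypercentral_residual_nil : nilpotent 'L_#|G|.+1(G).
Proof.
set D := 'L_#|G|.+1(G); have sDG: D \subset G := lcn_sub _ _.
apply/forall_inP=> H /subsetIP[sHD sHHD]; rewrite -subG1.
have sHR (p : nat): H \subset 'O_p^'(G).
  have nRG: G \subset 'N('O_p^'(G)) := gFnorm _ _.
  have nRD := subset_trans sDG nRG; have nRH := subset_trans sHD nRD.
  rewrite -quotient_sub1 // subG1.
  have := pgroup_nil (hypercentral_residual_pgroup p); move/forall_inP; apply.
  by rewrite subsetI quotientS //= -quotientR // quotientS.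
have [-> // | [p p_pr p_dv]] := trivgVpdiv H.
have := pgroupP (pgroupS (sHR p) (pcore_pgroup _ _)) p p_pr p_dv.
by rewrite !inE eqxx.
Qed.

(** If [G / 'O_p^'(G)] is a [p]-group, the residual is a [p']-group; otherwise
    every subgroup of ['O_p(G)] is normal in [G]. *)
Lemma hypercentral_residual_norm (X : {group gT}) :
  X \subset 'L_#|G|.+1(G) -> G \subset 'N(X).
Proof.
set D := 'L_#|G|.+1(G) => sXD; have nilD: nilpotent D := hypercentral_residual_nil.
rewrite -(Sylow_gen X) norms_gen // norms_bigcup //.
apply/bigcapsP=> S /SylowP[p p_pr sylS].
have [sSX pS] := (pHall_sub sylS, pHall_pgroup sylS).
have sSD := subset_trans sSX sXD.
have [pG | [nOG _]] := hypercentral_dichotomy p.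
  have nRG: G \subset 'N('O_p^'(G)) := gFnorm _ _.
  have D1: 'L_#|G|.+1(G / 'O_p^'(G)) = 1.
    apply/(lcn_nil_classP _ (pgroup_nil pG)).
    have := pgroup_nil pG; rewrite nilpotent_class => /ltnW le_cl.
    exact: leq_trans le_cl (leq_quotient _ _).
  have sDR: D \subset 'O_p^'(G).
    rewrite -quotient_sub1 ?(subset_trans (lcn_sub _ _)) //.
    by rewrite -D1 /quotient morphim_lcn.
  have p'S := pgroupS (subset_trans sSD sDR) (pcore_pgroup _ _).
  by rewrite (pgroup_p'group_trivial pS p'S) norm1 subsetT.
apply: nOG; apply: (@subset_trans _ _ (mem 'O_p(D))).
  by rewrite (sub_Hall_pcore (nilpotent_pcore_Hall p nilD)).
by rewrite pcore_max ?pcore_pgroup // gFnormal_trans ?lcn_normal.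
Qed.

End HypercentralSections.

Lemma subnormal_nil_Fitting (gT : finGroupType) (A G : {group gT}) :
  A <|<| G -> nilpotent A -> A \subset 'F(G).
Proof.
have [n] := ubnP #|G|; elim: n G => // n IHn G ltGn snAG nilA.
have [defA | [K [snAK nsKG prKG]]] := subnormalEr snAG.
  by rewrite defA nilpotent_Fitting // -defA.
have ltKn: #|K| < n := leq_trans (proper_card prKG) ltGn.
apply: subset_trans (IHn K ltKn snAK nilA) _.
by rewrite Fitting_max ?Fitting_nil ?gFnormal_trans.
Qed.

(** The last term ['L_n(A)] of the lower central series of a subnormal subgroup
    [A] lies in [A :&: 'L_n(G)], which is normal in [G], so [A] is nilpotent
    modulo its core and the section of its closure is nilpotent. *)
Lemma L_nil_sub_L_Delta_PST (gT : finGroupType) (G : {group gT}) :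
    solvable G -> L_nil G \subset L_Delta (central_chief_factors G) G ->
  PST_group G.
Proof.
move=> solG sLL; apply/forall_inP=> A snAG; have sAG := subnormal_sub snAG.
set T := normal_closure A G; set L := gcore A G.
have nsLG: L <| G := gcore_normal sAG.
have nsTG: T <| G := normal_closure_normal sAG.
have sAT: A \subset T := sub_normal_closure A G.
have sLA: L \subset A := gcore_sub A G.
have nLG := normal_norm nsLG; have nLA := subset_trans sAG nLG.
have sDL: 'L_#|G|.+1(A) \subset L.
  have sDD: 'L_#|G|.+1(A) \subset 'L_#|G|.+1(G) := lcnS _ sAG.
  by rewrite gcore_max ?lcn_sub // hypercentral_residual_norm.
have nilA: nilpotent (A / L).
  apply/lcnP; exists #|G|; rewrite -[LHS]/('L_#|G|.+1(coset L @* A)).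
  by rewrite -morphim_lcn //; apply: quotientS1.
have nilT: nilpotent (T / L).
  apply: nilpotentS (Fitting_nil (G / L)).
  rewrite sub_quotient_pre; last exact: subset_trans (normal_sub nsTG) nLG.
  apply: normal_closure_min; last by rewrite norm_quotient_pre ?gFnorm.
  rewrite -sub_quotient_pre // subnormal_nil_Fitting //.
  exact: quotient_subnormal.
have /(subsetP sLL): A \in L_nil G by rewrite inE sAG.
rewrite inE sAG => centA; apply: S_permutable_of_p'cent => // p Q.
exact: central_section_p'cent nsTG nsLG (subset_trans sLA sAT) centA.
Qed.

Theorem theorem1p5 (gT : finGroupType) (G : {group gT}) (solG : solvable G) :
  PST_group G <-> L_nil G = L_Delta (central_chief_factors G) G.
Proof.
split=> [pstG | eqLL].
  apply/eqP; rewrite eqEsubset PST_L_nil_sub_L_Delta //.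
  exact: L_Delta_sub_L_nil.
by apply: L_nil_sub_L_Delta_PST => //; rewrite eqLL.
Qed.
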